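(* Let $\Omega\subset\mathbb{R}^{2d}$ be measurable with $0<|\Omega|<\infty$. Then $$\sup_{f\in L^2(\mathbb{R}^d)\setminus\{0\}}\frac{\|Wf\|_{L^\infty(\Omega)}}{\|f\|_{L^2}^2}=2^d,$$ and the supremum is attained.
   Context: For $f\in L^2(\mathbb{R}^d)$ the Wigner distribution is $$Wf(z)=\int_{\mathbb{R}^d} e^{-2\pi i\,\xi\cdot y} f\Big(x+\frac{y}{2}\Big)\overline{f\Big(x-\frac{y}{2}\Big)}\,dy,\qquad z=(x,\xi)\in\mathbb{R}^{2d}.$$ $\|\cdot\|_{L^\infty(\Omega)}$ is the essential supremum norm over $\Omega$. *)

(* Defs.v *)
From HB Require Import structures.
From mathcomp Require Import all_boot all_order all_algebra.
From mathcomp Require Import complex.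
From mathcomp Require Import all_classical all_reals all_analysis.

Set Implicit Arguments.
Unset Strict Implicit.
Unset Printing Implicit Defensive.

Import Order.TTheory GRing.Theory Num.Theory.
Import numFieldNormedType.Exports.

Local Open Scope classical_set_scope.
Local Open Scope ring_scope.

Section lebesgue_outer.
Context {R : realType} {d : nat}.
Implicit Types (a b x : 'rV[R]_d) (A : set 'rV[R]_d).

Definition box a b : set 'rV[R]_d :=
  [set x | forall i, a ord0 i < x ord0 i <= b ord0 i].

Definition box_volume a b : R := \prod_(i < d) (b ord0 i - a ord0 i).

(* A family of boxes ]a_k, b_k] indexed by a countable set D is encoded by a
   sequence together with the set of relevant indices, so that finite and
   empty families are allowed in every dimension. *)
Definition box_cover A (c : set nat * (nat -> 'rV[R]_d * 'rV[R]_d)) : Prop :=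
  (forall k i, (c.2 k).1 ord0 i <= (c.2 k).2 ord0 i) /\
  A `<=` \bigcup_(k in c.1) box (c.2 k).1 (c.2 k).2.

Definition lebesgue_outer A : \bar R :=
  ereal_inf [set (\esum_(k in c.1) (box_volume (c.2 k).1 (c.2 k).2)%:E)%E
            | c in box_cover A].

Lemma box_volume_ge0 a b : (forall i, a ord0 i <= b ord0 i) ->
  0 <= box_volume a b.
Proof. by move=> ab; apply: prodr_ge0 => i _; rewrite subr_ge0. Qed.

Lemma lebesgue_outer_ge0 A : (0 <= lebesgue_outer A)%E.
Proof.
apply: le_ereal_inf_tmp => _ [c [cab _] <-].
by apply: esum_ge0 => k _; rewrite lee_fin box_volume_ge0.
Qed.

Lemma lebesgue_outer0 : lebesgue_outer set0 = 0%E.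
Proof.
apply/eqP; rewrite eq_le lebesgue_outer_ge0 andbT.
apply: ereal_inf_lbound; exists (set0, fun=> (0, 0)); last by rewrite /= esum_set0.
by split.
Qed.

Lemma le_lebesgue_outer : {homo lebesgue_outer : A B / A `<=` B >-> (A <= B)%E}.
Proof.
move=> A B AB; apply/ereal_inf_le_tmp => _ [c [cab Bc] <-].
by exists c => //; split => //; exact: subset_trans Bc.
Qed.

Lemma lebesgue_outer_sigma_subadditive : sigma_subadditive lebesgue_outer.
Proof.
move=> A; have [[i ioo]|] := pselect (exists i, lebesgue_outer (A i) = +oo%E).
  rewrite (eseries_pinfty _ _ ioo) ?leey// => n _.
  by rewrite -ltNye (lt_le_trans _ (lebesgue_outer_ge0 _)).
rewrite -forallNE => Aoo.
apply/lee_addgt0Pr => _/posnumP[e].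
rewrite (le_trans _ (epsilon_trick _ _ _))//; last first.
  by move=> n; exact: lebesgue_outer_ge0.
pose vol (c : set nat * (nat -> 'rV[R]_d * 'rV[R]_d)) k :=
  (box_volume (c.2 k).1 (c.2 k).2)%:E.
pose P n c := box_cover (A n) c /\
  (\esum_(k in c.1) vol c k <=
   lebesgue_outer (A n) + (e%:num / (2 ^ n.+1)%:R)%:E)%E.
have [G PG] : {G & forall n, P n (G n)}.
  apply: (@choice _ _ P) => n; rewrite /P /lebesgue_outer.
  set S := (X in ereal_inf X); move infS : (ereal_inf S) => iS.
  case: iS infS => [r Sr|Soo|Soo].
  - have en1 : (0 < e%:num / (2 ^ n.+1)%:R)%R by [].
    have /(lb_ereal_inf_adherent en1) : ereal_inf S \is a fin_num by rewrite Sr.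
    move=> [x [c cA <-] xS].
    by exists c; split => //; rewrite -Sr; exact/ltW.
  - by have := Aoo n; rewrite /lebesgue_outer Soo.
  - by have := lebesgue_outer_ge0 (A n); rewrite /lebesgue_outer Soo.
have G_ge0 n k : (0 <= vol (G n) k)%E.
  by rewrite lee_fin box_volume_ge0//; apply: (PG n).1.1.
have /card_esym/ppcard_eqP[f] := card_nat2.
pose D := [set nk : nat * nat | (G nk.1).1 nk.2].
pose H k := (G (f k).1).2 (f k).2.
apply: (@le_trans _ _ (\esum_(k in f @^-1` D) (box_volume (H k).1 (H k).2)%:E)%E).
  apply: ereal_inf_lbound; exists (f @^-1` D, H) => //=; split => /=.
    by move=> k i; apply: (PG _).1.1.
  move=> x [n _ Anx]; have [k Gk xk] := (PG n).1.2 _ Anx.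
  by exists (f^-1%FUN (n, k)); rewrite /= /H/= /D/= invK ?inE.
have -> : (\esum_(k in f @^-1` D) (box_volume (H k).1 (H k).2)%:E =
    \esum_(nk in D) vol (G nk.1) nk.2)%E.
  symmetry; apply: (@reindex_esum _ _ _ (f @^-1` D) D f (fun nk => vol (G nk.1) nk.2)).
  split.
  - by move=> k.
  - by move=> x y _ _ /(congr1 f^-1%FUN); rewrite !funK ?inE.
  - by move=> y Dy; exists (f^-1%FUN y); rewrite /= ?invK ?inE.
have -> : D = setT `*`` (fun n => (G n).1).
  by apply/seteqP; split => [[n k]//=|[n k]/= []].
rewrite -(@esum_esum _ _ _ setT (fun n => (G n).1) (fun n k => vol (G n) k))//.
rewrite -(nneseries_esumT (a := fun n => (\esum_(k in (G n).1) vol (G n) k)%E))//.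
  apply: lee_nneseries => [n _ _|n _]; first by apply: esum_ge0 => k _.
  exact: (PG n).2.
by move=> n; apply: esum_ge0 => k _.
Qed.

HB.instance Definition _ := isOuterMeasure.Build R _ lebesgue_outer
  lebesgue_outer0 lebesgue_outer_ge0 le_lebesgue_outer
  lebesgue_outer_sigma_subadditive.

End lebesgue_outer.

(* R^d with the sigma-algebra of Lebesgue (i.e. Caratheodory) measurable sets,
   as the library does in dimension 1 for completed_lebesgue_measure. *)
Definition eucl (R : realType) (d : nat) : Type :=
  caratheodory_type (@lebesgue_outer R d).

HB.instance Definition _ (R : realType) (d : nat) :=
  Measurable.on (eucl R d).

Definition lebesgue (R : realType) (d : nat) : set (eucl R d) -> \bar R :=
  lebesgue_outer.
Arguments lebesgue : clear implicits.

Section lebesgue_measure_instance.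
Variables (R : realType) (d : nat).
Let mu : {outer_measure set 'rV[R]_d -> \bar R} := @lebesgue_outer R d.

Let lebesgue0 : lebesgue R d set0 = 0%E.
Proof. exact: lebesgue_outer0. Qed.

Let lebesgue_ge0 (A : set (eucl R d)) : (0 <= lebesgue R d A)%E.
Proof. exact: lebesgue_outer_ge0. Qed.

Let lebesgue_sigma_additive : semi_sigma_additive (lebesgue R d).
Proof. exact: (@caratheodory_measure_sigma_additive R _ mu). Qed.

HB.instance Definition _ := isMeasure.Build _ (eucl R d) R (lebesgue R d)
  lebesgue0 lebesgue_ge0 lebesgue_sigma_additive.

End lebesgue_measure_instance.

Section wigner.
Context {R : realType}.

Definition cexpi (t : R) : R[i] := Complex (cos t) (sin t).

Definition cintegral (d : nat) (g : eucl R d -> R[i]) : R[i] :=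
  Complex (\int[lebesgue R d]_x complex.Re (g x))
          (\int[lebesgue R d]_x complex.Im (g x)).

Definition dotr (d : nat) (x y : 'rV[R]_d) : R :=
  \sum_(i < d) x ord0 i * y ord0 i.

(* A point z = (x, xi) of R^(2d) is a row vector of length d + d, with
   x = lsubmx z and xi = rsubmx z. *)
Definition wigner (d : nat) (f : eucl R d -> R[i]) (z : eucl R (d + d)) : R[i] :=
  let x := lsubmx (z : 'rV[R]_(d + d)) in
  let xi := rsubmx (z : 'rV[R]_(d + d)) in
  cintegral (fun y : 'rV[R]_d =>
    cexpi (- (2 * pi * dotr xi y)) *
    f (x + 2^-1 *: y) * conjc (f (x - 2^-1 *: y))).

Definition L2norm (d : nat) (f : eucl R d -> R[i]) : \bar R :=
  'N[lebesgue R d]_2%:E[(fun x => (ComplexField.Normc.normc (f x))%:E)]%E.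

(* Elements of L^2 are handled through representatives: f represents a
   nonzero class when it does not vanish almost everywhere. *)
Definition L2 (d : nat) : set (eucl R d -> R[i]) :=
  [set f | [/\ measurable_fun setT (fun x => complex.Re (f x)),
               measurable_fun setT (fun x => complex.Im (f x)) &
               (L2norm f < +oo)%E]].

Definition L2_nonzero (d : nat) : set (eucl R d -> R[i]) :=
  [set f | L2 f /\ ~ {ae lebesgue R d, forall x, f x = 0}].

Definition Linfnorm (d : nat) (Omega : set (eucl R d))
    (mOmega : measurable Omega) (g : eucl R d -> R[i]) : \bar R :=
  'N[mrestr (lebesgue R d) mOmega]_+oo[(fun z => (ComplexField.Normc.normc (g z))%:E)]%E.

End wigner.

(* Main.v *)
Require Import Defs.
From HB Require Import structures.
From mathcomp Require Import all_boot all_order all_algebra.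
From mathcomp Require Import complex.
From mathcomp Require Import all_classical all_reals all_analysis.
From mathcomp Require Import measurable_realfun ring lra.

(** The upper bound holds at every point z = (x, xi): the integrand of Wf(z) has
    modulus |f(x + y/2)| |f(x - y/2)|, at most half of |f(x + y/2)|^2 +
    |f(x - y/2)|^2, and the substitutions u = x + y/2 and u = x - y/2 turn the
    integral of each square into 2^d times the squared norm of f ([wigner_le]).

    The bound is attained pointwise wherever f(x + y/2) and f(x - y/2) agree up to
    the phase that xi removes: for instance at (x0, xi0) when f is an even
    function translated to x0 and modulated by xi0.  The function taken here is
    the modulated indicator of a cube ([modulated_cube]), for which only measures
    of cubes are needed, and whose Wigner distribution is bounded below near
    (x0, xi0) by elementary estimates that tend to 2^d times the squared norm
    ([wigner_modulated_cube_ge], [lower_factor_limit]).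

    An essential supremum sees only positive measure, so (x0, xi0) must be a point
    all of whose neighbourhoods meet Omega in positive measure.  Such a point
    exists because Omega is not null ([exists_support_point]), and the modulated
    cube centred there attains 2^d exactly.

    These arguments use a small amount of measure theory for the d-dimensional
    Lebesgue outer measure defined by covers with half-open boxes: its behaviour
    under affine maps ([lebesgue_outer_affine]), the measurability of half-spaces
    ([measurable_halfspace]), and the fact that a cube has finite positive measure.
    The measure of the cube cancels in the quotient; its positivity follows from
    that of Omega ([lebesgue_cube_gt0]). *)

Import Order.TTheory GRing.Theory Num.Theory.
Import numFieldNormedType.Exports.
Local Open Scope classical_set_scope.
Local Open Scope ring_scope.

Set Implicit Arguments.
Unset Strict Implicit.
Unset Printing Implicit Defensive.

(** * How Lebesgue outer measure transforms under maps *)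

Section transport.
Variable R : realType.

Lemma le_esumZl (D : set nat) (K : R) (v : nat -> R) :
  0 < K -> (forall k, 0 <= v k) ->
  (\esum_(k in D) (K * v k)%:E <= K%:E * \esum_(k in D) (v k)%:E)%E.
Proof.
move=> K0 v0; apply: ge_ereal_sup => _ [F [finF FD] <-].
rewrite (eq_fsbigr (fun k => K%:E * (v k)%:E)%E); last first.
  by move=> k _; rewrite EFinM.
rewrite -ge0_mule_fsumr//.
apply: lee_wpmul2l; first by rewrite lee_fin ltW.
by apply: ereal_sup_ubound; exists F.
Qed.

(** A map that pulls every box back into a box of at most [K] times its volume
    pulls covers back to covers, hence multiplies the outer measure by at most
    [K].  The dimensions may differ, and the pullback may be restricted to a
    set [G]: this also gives the comparison of a cube with its Cartesian
    square in [le_lebesgue_cube_double]. *)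
Lemma lebesgue_outer_transport (n m : nat) (K : R) (G : set 'rV[R]_n)
    (phi : 'rV[R]_n -> 'rV[R]_m)
    (F : 'rV[R]_m * 'rV[R]_m -> 'rV[R]_n * 'rV[R]_n) :
  0 < K ->
  (forall c : 'rV[R]_m * 'rV[R]_m, (forall i, c.1 ord0 i <= c.2 ord0 i) ->
     [/\ forall i, (F c).1 ord0 i <= (F c).2 ord0 i,
         phi @^-1` box c.1 c.2 `&` G `<=` box (F c).1 (F c).2 &
         box_volume (F c).1 (F c).2 <= K * box_volume c.1 c.2]) ->
  forall A, (lebesgue_outer (phi @^-1` A `&` G) <= K%:E * lebesgue_outer A)%E.
Proof.
move=> K0 HF A; rewrite -lee_pdivrMl//.
apply/ereal_infP => _ [c [cab Ac] <-].
rewrite lee_pdivrMl//; apply: le_trans; last first.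
  by apply: le_esumZl => // k; exact: box_volume_ge0.
apply: (@le_trans _ _ (\esum_(k in c.1)
    (box_volume (F (c.2 k)).1 (F (c.2 k)).2)%:E)%E); last first.
  by apply: le_esum => k _; rewrite lee_fin; have [] := HF _ (cab k).
apply: ereal_inf_lbound; exists (c.1, F \o c.2) => //.
split=> /= [k i|x [Ax Gx]]; first by have [] := HF _ (cab k).
have [k ck xk] := Ac _ Ax; exists k => //.
by have [_ + _] := HF _ (cab k); apply.
Qed.

End transport.

Section affine.
Variables (R : realType) (d : nat).
Implicit Types (x y a b : 'rV[R]_d) (t : R).

Definition affine x t y : 'rV[R]_d := x + t *: y.

(** For [t < 0] the preimage of the half-open box ]a, b] is closed at its other
    end, so it is not a box.  Dilating it about its centre by any factor larger
    than 1 repairs this, and works for both signs of [t] at once; an empty box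
    has an empty preimage, so degenerate sides do no harm.  The dilation factor
    is removed by a limit in [le_affine]. *)
Lemma le_lebesgue_outer_affine x t K (A : set 'rV[R]_d) :
  t != 0 -> `|t|^-1 < K ->
  (lebesgue_outer (affine x t @^-1` A) <= (K ^+ d)%:E * lebesgue_outer A)%E.
Proof.
move=> t0 tK; have ti : 0 < `|t|^-1 by rewrite invr_gt0 normr_gt0.
have K0 : 0 < K by exact: lt_trans tK.
(* The end points, for s = -1 and s = 1, of the preimage of the box, dilated
   about its centre by the factor K |t|. *)
pose mid (c : 'rV[R]_d * 'rV[R]_d) (s : R) :=
  \row_(i < d) (((c.1 ord0 i + c.2 ord0 i) / 2 - x ord0 i) / t +
                s * (K * (c.2 ord0 i - c.1 ord0 i) / 2)).
rewrite -[affine x t @^-1` A]setIT.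
apply: (@lebesgue_outer_transport _ _ _ _ _ _ (fun c => (mid c (-1), mid c 1))).
  exact: exprn_gt0.
move=> c cab; split=> /=.
- move=> i; rewrite !mxE; have := cab i.
  rewrite -subr_ge0 => h; have : 0 <= K * (c.2 ord0 i - c.1 ord0 i) by rewrite mulr_ge0// ltW.
  lra.
- move=> y [+ _] i => /(_ i); rewrite !mxE => /andP[].
  set a := c.1 ord0 i; set b := c.2 ord0 i; set u := x ord0 i.
  move=> h1 h2; have ab : 0 < b - a by lra.
  have : `|y ord0 i - ((a + b) / 2 - u) / t| < K * (b - a) / 2.
    have -> : y ord0 i - ((a + b) / 2 - u) / t =
        t^-1 * (u + t * y ord0 i - (a + b) / 2) by field.
    rewrite normrM normfV -mulrA.
    apply: (@le_lt_trans _ _ (`|t|^-1 * ((b - a) / 2))).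
      rewrite ler_wpM2l// ?(ltW ti)// ler_norml; apply/andP; split; lra.
    by rewrite ltr_pM2r//; lra.
  rewrite ltr_norml => /andP[]; lra.
- rewrite /box_volume -[K ^+ d](_ : \prod_(i < d) K = _); last by rewrite prodr_const card_ord.
  rewrite -big_split/= le_eqVlt; apply/orP; left; apply/eqP.
  by apply: eq_bigr => i _; rewrite !mxE; lra.
Qed.

Lemma affine_inv x t : t != 0 ->
  forall A : set 'rV[R]_d,
  affine x t @^-1` (affine (- (t^-1 *: x)) t^-1 @^-1` A) = A.
Proof.
move=> t0 A; apply/seteqP; split=> y; rewrite /= /affine scalerDr scalerA mulVf//;
  by rewrite scale1r addKr.
Qed.

Lemma le_expr_right (p r k : R) n : (forall K, k < K -> p <= K ^+ n * r) ->
  p <= k ^+ n * r.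
Proof.
move=> H.
have cv : (fun K : R => K ^+ n * r) @ k^'+ --> k ^+ n * r.
  apply: cvgM; last exact: cvg_cst.
  apply: cvg_at_right_filter; exact: exprn_continuous.
apply: (@cvgr_to_ge _ _ _ _ _ _ _ cv).
near=> K; apply: H; near: K; exact: nbhs_right_gt.
Unshelve. all: by end_near. Qed.

Let le_affine x t (A : set 'rV[R]_d) : t != 0 ->
  (lebesgue_outer (affine x t @^-1` A) <= (`|t|^-1 ^+ d)%:E * lebesgue_outer A)%E.
Proof.
move=> t0; have ti : 0 < `|t|^-1 by rewrite invr_gt0 normr_gt0.
have := @le_lebesgue_outer_affine x t _ A t0.
have := lebesgue_outer_ge0 (affine x t @^-1` A); have := lebesgue_outer_ge0 A.
case: (lebesgue_outer A) => [r| |]//; last first.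
  by move=> _ _ _; rewrite gt0_muley ?lte_fin ?exprn_gt0// leey.
case: (lebesgue_outer _) => [p| |]//; last first.
  by move=> _ _ /(_ (`|t|^-1 + 1)); rewrite ltrDl => /(_ ltr01); rewrite -EFinM leye_eq.
move=> r0 p0 H; rewrite -EFinM lee_fin; apply: le_expr_right => K tK.
by rewrite -lee_fin EFinM; exact: H.
Qed.

Lemma lebesgue_outer_affine x t (A : set 'rV[R]_d) : t != 0 ->
  lebesgue_outer (affine x t @^-1` A) = ((`|t|^-1 ^+ d)%:E * lebesgue_outer A)%E.
Proof.
move=> t0; have ti : 0 < `|t|^-1 by rewrite invr_gt0 normr_gt0.
apply/eqP; rewrite eq_le le_affine//=.
rewrite -lee_pdivlMl ?exprn_gt0// -exprVn invrK.
rewrite -{1}[A](@affine_inv (- (t^-1 *: x)) t^-1) ?invr_eq0// invrK.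
have := @le_affine (- (t^-1 *: x)) t^-1 (affine x t @^-1` A).
rewrite invr_eq0 normfV invrK => /(_ t0).
by rewrite scalerN scalerA divff// scale1r opprK.
Qed.

(** The outer measure of every set is scaled by the same factor, so splitting a
    test set by the preimage of a Caratheodory set loses nothing. *)
Lemma measurable_affine x t : t != 0 ->
  measurable_fun [set: eucl R d] (affine x t : eucl R d -> eucl R d).
Proof.
move=> t0 _ A mA; rewrite setTI.
have mA' : (@lebesgue_outer R d).-caratheodory A := mA.
suff : (@lebesgue_outer R d).-caratheodory (affine x t @^-1` A) by [].
move=> X; have [Y ->] : exists Y, X = affine x t @^-1` Y.
  by exists (affine (- (t^-1 *: x)) t^-1 @^-1` X); rewrite affine_inv.
change (lebesgue_outer (affine x t @^-1` Y) =
  (lebesgue_outer (affine x t @^-1` (Y `&` A)) +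
   lebesgue_outer (affine x t @^-1` (Y `&` ~` A)))%E).
rewrite !(@lebesgue_outer_affine x t _ t0).
have -> := mA' Y.
by rewrite ge0_muleDr; [|exact: lebesgue_outer_ge0|exact: lebesgue_outer_ge0].
Qed.

End affine.

(** * Measurability of boxes and coordinates *)

Section measurable_coordinates.
Variables (R : realType) (d : nat).
Implicit Types (a b x : 'rV[R]_d).

(** A coordinate hyperplane cuts each box of a cover into two boxes whose volumes
    add up, so a half-space satisfies the Caratheodory criterion. *)
Lemma measurable_halfspace (i : 'I_d) (r : R) :
  measurable ([set x | x ord0 i <= r] : set (eucl R d)).
Proof.
pose H : set 'rV[R]_d := [set x | x ord0 i <= r].
suff : (@lebesgue_outer R d).-caratheodory H by [].
apply: le_caratheodory_measurable => X /=.
apply/ereal_infP => _ [c [cab Xc] <-].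
(* The cut is clamped to the box, so one of the two pieces may be degenerate. *)
pose mid (k : nat) := Num.max ((c.2 k).1 ord0 i) (Num.min ((c.2 k).2 ord0 i) r).
pose upd (u : 'rV[R]_d) (s : R) := \row_j (if j == i then s else u ord0 j) : 'rV[R]_d.
have midP k : (c.2 k).1 ord0 i <= mid k <= (c.2 k).2 ord0 i.
  by rewrite le_max lexx/= ge_max cab/= ge_min lexx.
have lo : box_cover (X `&` H) (c.1, fun k => ((c.2 k).1, upd (c.2 k).2 (mid k))).
  split=> /= [k j|x [Xx Hx]].
    by rewrite mxE; case: eqP => [->|_]; [have /andP[] := midP k|exact: cab].
  have [k ck xk] := Xc _ Xx; exists k => // j.
  have /andP[xj1 xj2] := xk j; rewrite mxE xj1/=; case: eqP => [ji|//].
  by rewrite /mid le_max le_min -ji xj2 ji Hx orbT.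
have hi : box_cover (X `&` ~` H) (c.1, fun k => (upd (c.2 k).1 (mid k), (c.2 k).2)).
  split=> /= [k j|x [Xx /negP]].
    by rewrite mxE; case: eqP => [->|_]; [have /andP[] := midP k|exact: cab].
  rewrite -ltNge => Hx.
  have [k ck xk] := Xc _ Xx; exists k => // j.
  have /andP[xj1 xj2] := xk j; rewrite mxE xj2 andbT; case: eqP => [ji|//].
  by rewrite /mid gt_max gt_min -ji xj1/= ji Hx orbT.
apply: (@le_trans _ _ (\esum_(k in c.1) (box_volume (c.2 k).1 (upd (c.2 k).2 (mid k)))%:E +
   \esum_(k in c.1) (box_volume (upd (c.2 k).1 (mid k)) (c.2 k).2)%:E)%E).
  apply: leeD; apply: ereal_inf_lbound.
    by exists (c.1, fun k => ((c.2 k).1, upd (c.2 k).2 (mid k))).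
  by exists (c.1, fun k => (upd (c.2 k).1 (mid k), (c.2 k).2)).
rewrite -esumD; first last.
- by move=> k _; rewrite lee_fin; apply: box_volume_ge0 => j; apply: hi.1.
- by move=> k _; rewrite lee_fin; apply: box_volume_ge0 => j; apply: lo.1.
apply: le_esum => k _; rewrite -EFinD lee_fin.
have volE u v : box_volume u v = (v ord0 i - u ord0 i) *
    \prod_(j < d | j != i) (v ord0 j - u ord0 j) by rewrite /box_volume (bigD1 i).
rewrite !volE !mxE eqxx.
rewrite [X in _ * X + _ <= _](eq_bigr (fun j => (c.2 k).2 ord0 j - (c.2 k).1 ord0 j)); last first.
  by move=> j /negbTE ji; rewrite !mxE ji.
rewrite [X in _ + _ * X <= _](eq_bigr (fun j => (c.2 k).2 ord0 j - (c.2 k).1 ord0 j)); last first.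
  by move=> j /negbTE ji; rewrite !mxE ji.
by rewrite -mulrDl addrC addrA subrK.
Qed.

Lemma measurable_coord (i : 'I_d) :
  measurable_fun [set: eucl R d] (fun x : eucl R d => (x : 'rV[R]_d) ord0 i).
Proof.
apply: (measurability _ (RGenOInfty.measurableE R)).
move=> _ [_ [r ->] <-]; rewrite setTI.
rewrite (_ : _ @^-1` _ = ~` [set x : 'rV[R]_d | x ord0 i <= r]).
  exact: measurableC (measurable_halfspace i r).
by apply/seteqP; split=> x /=; rewrite in_itv/= andbT ltNge => /negP.
Qed.

Lemma measurable_box a b : measurable (box a b : set (eucl R d)).
Proof.
have -> : box a b = \big[setI/setT]_(i < d)
    ([set x : 'rV[R]_d | x ord0 i <= b ord0 i] `&`
     ~` [set x : 'rV[R]_d | x ord0 i <= a ord0 i]).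
  rewrite -bigcap_seq; apply/seteqP; split=> x /=.
    by move=> abx i _ /=; have /andP[ax xb] := abx i; split=> //; apply/negP; rewrite -ltNge.
  move=> abx i; have /= [xb /negP] := abx i (mem_index_enum i).
  by rewrite -ltNge xb andbT.
apply: (@bigsetI_measurable _ (eucl R d)) => i _.
apply: measurableI; first exact: measurable_halfspace.
by apply: measurableC; exact: measurable_halfspace.
Qed.

End measurable_coordinates.

(** * Cubes *)

Section cube.
Variable R : realType.

Definition cube (d : nat) (x : 'rV[R]_d) (r : R) : set 'rV[R]_d :=
  [set y | forall i, x ord0 i - r < y ord0 i <= x ord0 i + r].

Lemma cubeE d (x : 'rV[R]_d) r :
  cube x r = box (x - const_mx r) (x + const_mx r).
Proof. by apply/seteqP; split=> y /= xy i; have := xy i; rewrite !mxE. Qed.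

Lemma measurable_cube d (x : 'rV[R]_d) r :
  measurable (cube x r : set (eucl R d)).
Proof. by rewrite cubeE; exact: measurable_box. Qed.

Lemma lebesgue_cube_scale d (x : 'rV[R]_d) r : 0 < r ->
  lebesgue R d (cube x r) = ((r ^+ d)%:E * lebesgue R d (cube 0 1))%E.
Proof.
move=> r0; have ri : r^-1 != 0 by rewrite invr_neq0// gt_eqF.
have -> : cube x r = affine (- (r^-1 *: x)) r^-1 @^-1` cube 0 1.
  have E y i : (affine (- (r^-1 *: x)) r^-1 y) ord0 i = r^-1 * (y ord0 i - x ord0 i).
    by rewrite !mxE mulrBr addrC.
  apply/seteqP; split=> y /= xy i.
    have := xy i; rewrite E mxE !add0r ltr_pdivlMl// ler_pdivrMl//; lra.
  have := xy i; rewrite E mxE !add0r ltr_pdivlMl// ler_pdivrMl//; lra.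
rewrite /lebesgue lebesgue_outer_affine//.
by rewrite gtr0_norm ?invr_gt0// invrK.
Qed.

Lemma lebesgue_cube_lty d : (lebesgue R d (cube 0 1) < +oo)%E.
Proof.
apply: (@le_lt_trans _ _ (box_volume (0 - const_mx 1 : 'rV[R]_d) (0 + const_mx 1))%:E);
  last by rewrite ltry.
apply: ereal_inf_lbound.
exists ([set 0%N], fun=> (0 - const_mx 1 : 'rV[R]_d, 0 + const_mx 1)).
  split=> [k i /=|x x1]; first by rewrite !mxE; lra.
  by exists 0%N => //=; rewrite -cubeE.
by rewrite esum_set1// lee_fin box_volume_ge0// => i; rewrite !mxE; lra.
Qed.

(** Space is a countable union of dilates of the cube of radius 1, and dilation
    scales the measure. *)
Lemma lebesgue_null_of_cube d : lebesgue R d (cube 0 1) = 0%E ->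
  forall A : set (eucl R d), lebesgue R d A = 0%E.
Proof.
move=> c0 A; apply/eqP; rewrite eq_le measure_ge0 andbT.
have -> : (0 = \sum_(0 <= n <oo) lebesgue R d (cube 0 n.+1%:R))%E.
  by rewrite eseries0// => n _ _; rewrite lebesgue_cube_scale// c0 mule0.
apply: le_trans (lebesgue_outer_sigma_subadditive _).
apply: le_lebesgue_outer => x _.
pose M := \sum_i `|(x : 'rV[R]_d) ord0 i|.
exists (Num.truncn M) => // i; rewrite mxE !add0r -ltrNl.
have xM : `|(x : 'rV[R]_d) ord0 i| <= M.
  by rewrite /M (bigD1 i)//= lerDl sumr_ge0.
have := truncnS_gt M => MM.
have : `|(x : 'rV[R]_d) ord0 i| < (Num.truncn M).+1%:R by exact: le_lt_trans MM.
by rewrite ltr_norml => /andP[h1 h2]; apply/andP; split; lra.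
Qed.

(** A cover of the cube of R^d, multiplied by that cube, covers the cube of
    R^(2d); the second factor contributes the side length 2 to the power d. *)
Lemma le_lebesgue_cube_double d :
  (lebesgue R (d + d) (cube 0 1) <= (2 ^+ d)%:E * lebesgue R d (cube 0 1))%E.
Proof.
pose F (c : 'rV[R]_d * 'rV[R]_d) : 'rV[R]_(d + d) * 'rV[R]_(d + d) :=
  (row_mx c.1 (const_mx (-1)), row_mx c.2 (const_mx 1)).
suff : (lebesgue_outer (@lsubmx R 1 d d @^-1` cube 0 1 `&` cube 0 1) <=
    (2 ^+ d)%:E * lebesgue_outer (cube (0 : 'rV[R]_d) 1))%E.
  apply: le_trans; apply: le_lebesgue_outer => x x1; split=> // i.
  by have := x1 (lshift d i); rewrite !mxE.
apply: (@lebesgue_outer_transport R (d + d) d (2 ^+ d) (cube 0 1) (@lsubmx R 1 d d) F).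
    by rewrite exprn_gt0.
  move=> c cab; split=> /=.
  - by move=> i; case: (split_ordP i) => j ->;
      rewrite ?row_mxEl ?row_mxEr ?mxE//; lra.
  - move=> x [xc x1] i; case: (split_ordP i) => j ->.
      by rewrite !row_mxEl; have := xc j; rewrite !mxE.
    by rewrite !row_mxEr; have := x1 (rshift d j); rewrite !mxE; lra.
  - rewrite /box_volume big_split_ord/= mulrC.
    rewrite (eq_bigr (fun=> 2)); last by move=> i _; rewrite !row_mxEr !mxE; lra.
    rewrite prodr_const card_ord.
    by rewrite (eq_bigr (fun i => c.2 ord0 i - c.1 ord0 i))// => i _; rewrite !row_mxEl.
Qed.

(** If the cube of R^d were null then so would be the cube of R^(2d), hence all of
    R^(2d), including [A]. *)
Lemma lebesgue_cube_gt0 d (A : set (eucl R (d + d))) :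
  (0 < lebesgue R (d + d) A)%E -> (0 < lebesgue R d (cube 0 1))%E.
Proof.
rewrite !lt0e !measure_ge0 !andbT => A0; apply: contra_neq A0 => c0.
apply: lebesgue_null_of_cube; apply/eqP; rewrite eq_le measure_ge0 andbT.
by rewrite (le_trans (le_lebesgue_cube_double d))// c0 mule0.
Qed.

End cube.

(** * Points where a set has positive measure at every scale *)

Section support.
Variables (R : realType) (n : nat).

(** Otherwise each point of [A] lies in a cube with rational centre and radius
    1/(m+1) that meets [A] in a null set; there are countably many such cubes. *)
Lemma exists_support_point (A : set (eucl R n)) :
  (0 < lebesgue R n A)%E ->
  exists z : 'rV[R]_n, forall r, 0 < r -> (0 < lebesgue R n (A `&` cube z r))%E.
Proof.
move=> A0; apply: contrapT => /forallNP noz.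
have nullz (z : 'rV[R]_n) : exists2 r, 0 < r & lebesgue R n (A `&` cube z r) = 0%E.
  have /existsNP[r /not_implyP[r0 /negP]] := noz z.
  rewrite lt0e measure_ge0 andbT negbK => /eqP rz; by exists r.
pose C (c : 'rV[rat]_n * nat) : set 'rV[R]_n := A `&` cube (map_mx ratr c.1) c.2.+1%:R^-1.
pose F (k : nat) : set 'rV[R]_n :=
  if unpickle k is Some c then (if lebesgue_outer (C c) == 0%E then C c else set0) else set0.
have F0 k : lebesgue_outer (F k) = 0%E.
  rewrite /F; case: unpickle => [c|]; last exact: lebesgue_outer0.
  by case: ifPn => [/eqP//|_]; exact: lebesgue_outer0.
suff AF : A `<=` \bigcup_k F k.
  have := le_trans (le_lebesgue_outer AF) (lebesgue_outer_sigma_subadditive F).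
  rewrite eseries0; last by move=> k _ _; rewrite F0.
  by rewrite leNgt A0.
move=> z Az; have [r r0 zr] := nullz z.
(* A cube of radius 1/(m+1) containing z lies within 2/(m+1) of z. *)
pose m := Num.truncn (2 / r).
have m0 : 0 < m.+1%:R^-1 :> R by [].
have mr : 2 * m.+1%:R^-1 < r.
  by rewrite ltr_pdivrMr// mulrC -ltr_pdivrMr//; exact: truncnS_gt.
have [e eE] : exists e : R, e = m.+1%:R^-1 by exists m.+1%:R^-1.
have /choice[q qz] : forall i : 'I_n, exists q : rat,
    (ratr q : R) \in `](z : 'rV[R]_n) ord0 i - e, (z : 'rV[R]_n) ord0 i + e[.
  by move=> i; apply: rat_in_itvoo; rewrite ltrBlDr -addrA ltrDl addr_gt0// eE.
exists (pickle (\row_i q i, m)) => //.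
have Cz : C (\row_i q i, m) z.
  by split=> // i; rewrite /= !mxE -eE; have := qz i; rewrite in_itv/= => /andP[h1 h2]; apply/andP; split; lra.
rewrite /F pickleK ifT//.
rewrite eq_le lebesgue_outer_ge0 andbT -zr; apply: le_lebesgue_outer => y [Ay Cy].
split=> // i; have := Cy i; rewrite /= !mxE -eE; have := qz i; rewrite in_itv/=.
by move: mr; rewrite -eE => mr /andP[h1 h2] /andP[h3 h4]; apply/andP; split; lra.
Qed.

End support.

(** * Affine change of variables in integrals *)

Section change_of_variables.
Variables (R : realType) (d : nat).

Lemma ge0_integral_affine (x : 'rV[R]_d) (t : R) (f : eucl R d -> \bar R) :
  t != 0 -> measurable_fun setT f -> (forall y, 0 <= f y)%E ->
  (\int[lebesgue R d]_y f (affine x t y) =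
   (`|t|^-1 ^+ d)%:E * \int[lebesgue R d]_y f y)%E.
Proof.
move=> t0 mf f0; have k0 : 0 <= `|t|^-1 ^+ d by rewrite exprn_ge0// invr_ge0.
have mt := measurable_affine x t0.
have := @ge0_integral_pushforward _ _ _ _ R _ mt (lebesgue R d) setT f measurableT mf.
rewrite preimage_setT => <-; last by move=> y _.
rewrite (@eq_measure_integral _ _ _ _ (mscale (NngNum k0) (lebesgue R d))).
  by rewrite ge0_integral_mscale.
move=> A mA _; rewrite /pushforward/= /mscale/=.
exact: lebesgue_outer_affine.
Qed.

End change_of_variables.

(** * Complex-valued functions and their integrals *)

Section complex_functions.
Variable R : realType.
Local Notation normc := ComplexField.Normc.normc.

Definition sqnorm (z : R[i]) : R := complex.Re z ^+ 2 + complex.Im z ^+ 2.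

Lemma sqnorm_ge0 z : 0 <= sqnorm z.
Proof. by rewrite addr_ge0// sqr_ge0. Qed.

Lemma normc_sqrt z : normc z = Num.sqrt (sqnorm z).
Proof. by case: z. Qed.

Lemma normc_ge0 (z : R[i]) : 0 <= normc z.
Proof. by rewrite normc_sqrt sqrtr_ge0. Qed.

Lemma normc_sqnorm z : normc z ^+ 2 = sqnorm z.
Proof. by rewrite normc_sqrt sqr_sqrtr// sqnorm_ge0. Qed.

Lemma ReM (z w : R[i]) :
  complex.Re (z * w) = complex.Re z * complex.Re w - complex.Im z * complex.Im w.
Proof. by case: z w => [a b] [c e]. Qed.

Lemma ImM (z w : R[i]) :
  complex.Im (z * w) = complex.Re z * complex.Im w + complex.Im z * complex.Re w.
Proof. by case: z w => [a b] [c e]. Qed.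

Lemma normc_conjc (z : R[i]) : normc (conjc z) = normc z.
Proof. by case: z => a b /=; rewrite sqrrN. Qed.

Lemma normc_cexpi (t : R) : normc (cexpi t) = 1.
Proof. by rewrite /= cos2Dsin2 sqrtr1. Qed.

Lemma normr_Re_le (z : R[i]) : `|complex.Re z| <= normc z.
Proof.
by rewrite normc_sqrt -sqrtr_sqr ler_wsqrtr// lerDl sqr_ge0.
Qed.

Lemma normr_Im_le (z : R[i]) : `|complex.Im z| <= normc z.
Proof.
by rewrite normc_sqrt -sqrtr_sqr ler_wsqrtr// lerDr sqr_ge0.
Qed.

Lemma dot_le_normc (z w : R[i]) :
  complex.Re z * complex.Re w + complex.Im z * complex.Im w <= normc z * normc w.
Proof.
rewrite -(normc_conjc z) -ComplexField.Normc.normcM.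
apply: le_trans (normr_Re_le _); apply: le_trans (ler_norm _).
by rewrite ReM; case: z => a b /=; rewrite mulNr opprK.
Qed.

Section measurable.
Context d (T : measurableType d).
Implicit Types f g : T -> R[i].

Definition cmeasurable f :=
  measurable_fun setT (fun x => complex.Re (f x)) /\
  measurable_fun setT (fun x => complex.Im (f x)).

Lemma cmeasurableM f g : cmeasurable f -> cmeasurable g ->
  cmeasurable (fun x => f x * g x).
Proof.
move=> [rf jf] [rg jg]; split.
  under eq_fun do rewrite ReM.
  by apply: measurable_funB; apply: measurable_funM.
under eq_fun do rewrite ImM.
by apply: measurable_funD; apply: measurable_funM.
Qed.

Lemma cmeasurable_conjc f : cmeasurable f -> cmeasurable (fun x => conjc (f x)).
Proof.
move=> [rf jf]; split.
  by rewrite (_ : (fun x => _) = (fun x => complex.Re (f x)))//;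
    apply/funext => x; case: (f x).
rewrite (_ : (fun x => _) = (fun x => - complex.Im (f x)));
  last by apply/funext => x; case: (f x).
exact: measurable_funN.
Qed.

Lemma cmeasurable_cexpi (h : T -> R) : measurable_fun setT h ->
  cmeasurable (fun x => cexpi (h x)).
Proof.
move=> mh; split.
  by apply: (measurableT_comp (continuous_measurable_fun (@continuous_cos R)) mh).
by apply: (measurableT_comp (continuous_measurable_fun (@continuous_sin R)) mh).
Qed.

Lemma measurable_sqnorm f : cmeasurable f ->
  measurable_fun setT (fun x => sqnorm (f x)).
Proof.
by move=> [rf jf]; apply: measurable_funD; apply: measurable_funX.
Qed.

End measurable.

(** With [I] the integral of [g], the square of [|I|] is the integral of the real
    scalar product of [I] and [g y], which is at most [|I| h y]; divide by
    [|I|]. *)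
Lemma normc_cintegral_le d (g : eucl R d -> R[i]) (h : eucl R d -> R) :
  cmeasurable g -> (lebesgue R d).-integrable setT (EFin \o h) ->
  (forall y, normc (g y) <= h y) ->
  normc (cintegral g) <= \int[lebesgue R d]_y h y.
Proof.
move=> [mr mi] hint gh.
have h0 y : 0 <= h y by rewrite (le_trans (normc_ge0 (g y))).
have ri : (lebesgue R d).-integrable setT (EFin \o (fun y => complex.Re (g y))).
  apply: le_integrable hint => //; first exact/measurable_EFinP.
  move=> y _ /=; rewrite lee_fin (ger0_norm (h0 _)).
  exact: le_trans (normr_Re_le _) (gh _).
have ii : (lebesgue R d).-integrable setT (EFin \o (fun y => complex.Im (g y))).
  apply: le_integrable hint => //; first exact/measurable_EFinP.
  move=> y _ /=; rewrite lee_fin (ger0_norm (h0 _)).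
  exact: le_trans (normr_Im_le _) (gh _).
set I := cintegral g; set H := \int[lebesgue R d]_y h y.
have : normc I ^+ 2 <= normc I * H.
  have scale c u : (lebesgue R d).-integrable setT (EFin \o u) ->
      (lebesgue R d).-integrable setT (EFin \o (fun y : eucl R d => c * u y)).
    by move=> iu; have := @integrableZl _ _ _ (lebesgue R d) setT measurableT c _ iu.
  have -> : normc I * H = \int[lebesgue R d]_y (normc I * h y).
    by rewrite RintegralZl.
  have -> : normc I ^+ 2 = \int[lebesgue R d]_y
      (complex.Re I * complex.Re (g y) + complex.Im I * complex.Im (g y)).
    rewrite (RintegralD measurableT (scale _ _ ri) (scale _ _ ii)).
    by rewrite normc_sqnorm !RintegralZl.
  apply: le_Rintegral => //.
  - exact: (integrableD measurableT (scale _ _ ri) (scale _ _ ii)).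
  - exact: scale.
  - move=> y _; apply: (le_trans (dot_le_normc I (g y))).
    by apply: ler_wpM2l; [exact: normc_ge0|exact: gh].
have H0 : 0 <= H by apply: Rintegral_ge0.
have [->//|I0] := eqVneq (normc I) 0.
by rewrite expr2 ler_pM2l// lt0r I0 normc_ge0.
Qed.

End complex_functions.

(** * The pointwise bound on the Wigner distribution *)

Section wigner_bound.
Variables (R : realType) (d : nat).
Local Notation normc := ComplexField.Normc.normc.
Implicit Type f : eucl R d -> R[i].

Lemma sqr_L2norm f :
  (L2norm f ^+ 2 = \int[lebesgue R d]_x (sqnorm (f x))%:E)%E.
Proof.
have expe2E (x : \bar R) : (0 <= x -> x ^+ 2 = x `^ 2)%E.
  case: x => [r| |]//; last by rewrite poweRyr.
  by rewrite lee_fin => r0; rewrite poweR_EFin powR_mulrn// EFin_expe.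
rewrite expe2E ?Lnorm_ge0// poweR_Lnorm//.
apply: eq_integral => x _; rewrite abse_EFin ger0_norm ?normc_ge0//.
by rewrite poweR_EFin powR_mulrn ?normc_ge0// normc_sqnorm.
Qed.

Lemma sqr_L2norm_lty f : L2 f -> (L2norm f ^+ 2 < +oo)%E.
Proof.
move=> [_ _]; have : (0 <= L2norm f)%E := Lnorm_ge0 _ _ _.
by case: (L2norm f) => [r| |]// _ _; rewrite -EFin_expe ltry.
Qed.

Lemma sqr_L2norm_gt0 f : L2_nonzero f -> (0 < L2norm f ^+ 2)%E.
Proof.
move=> [[mr mi _] f0]; rewrite lt0e sqr_L2norm integral_ge0 ?andbT; last first.
  by move=> x _; rewrite lee_fin sqnorm_ge0.
apply/eqP => I0; apply: f0.
have mf : measurable_fun setT (fun x : eucl R d => (sqnorm (f x))%:E).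
  by apply/measurable_EFinP; exact: (measurable_sqnorm (conj mr mi)).
have /(ae_eq_integral_abs _ measurableT mf) : (\int[lebesgue R d]_x `|(sqnorm (f x))%:E| = 0)%E.
  by rewrite -I0; apply: eq_integral => x _; rewrite abse_EFin ger0_norm ?sqnorm_ge0.
apply: filterS => x /(_ I) /= [] /eqP; rewrite -normc_sqnorm sqrf_eq0 => /eqP.
exact: ComplexField.Normc.eq0_normc.
Qed.

Lemma cmeasurable_affine f x t : t != 0 -> cmeasurable f ->
  cmeasurable (fun y : eucl R d => f (affine x t y)).
Proof.
move=> t0 [mr mi]; have mt := measurable_affine x t0.
by split; [exact: (measurableT_comp mr mt)|exact: (measurableT_comp mi mt)].
Qed.

Lemma measurable_dotr (xi : 'rV[R]_d) :
  measurable_fun setT (fun y : eucl R d => dotr xi (y : 'rV[R]_d)).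
Proof.
rewrite /dotr.
apply: (@measurable_sum _ (eucl R d) R setT 'I_d (index_enum 'I_d)
  (fun i y => xi ord0 i * (y : 'rV[R]_d) ord0 i)) => i; apply: measurable_funM; first exact: measurable_cst.
exact: measurable_coord.
Qed.

(** The integrand has modulus [|p| |q|], where [p] and [q] are [f] composed with
    the affine maps of ratio 1/2 and -1/2; it is at most half the sum of the
    squares of [|p|] and [|q|], each of which integrates to 2^d times the squared
    norm of [f]. *)
Lemma wigner_le f z : L2 f ->
  ((normc (wigner f z))%:E <= (2 ^+ d)%:E * L2norm f ^+ 2)%E.
Proof.
move=> Lf; have [mr mi _] := Lf; have mf : cmeasurable f by [].
set x : 'rV[R]_d := lsubmx (z : 'rV[R]_(d + d)).
set xi : 'rV[R]_d := rsubmx (z : 'rV[R]_(d + d)).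
have i20 : 0 < 2^-1 :> R by [].
have t0 : 2^-1 != 0 :> R by rewrite gt_eqF.
have t0' : - 2^-1 != 0 :> R by rewrite oppr_eq0.
pose p (y : eucl R d) := f (affine x 2^-1 y).
pose q (y : eucl R d) := f (affine x (- 2^-1) y).
have mp : cmeasurable p by exact: cmeasurable_affine.
have mq : cmeasurable q by exact: cmeasurable_affine.
have Ip : (\int[lebesgue R d]_y (sqnorm (p y))%:E = (2 ^+ d)%:E * L2norm f ^+ 2)%E.
  rewrite sqr_L2norm (@ge0_integral_affine _ _ x _ (fun y => (sqnorm (f y))%:E) t0).
  - by rewrite gtr0_norm ?invr_gt0// invrK.
  - by apply/measurable_EFinP; exact: measurable_sqnorm.
  - by move=> y; rewrite lee_fin sqnorm_ge0.
have Iq : (\int[lebesgue R d]_y (sqnorm (q y))%:E = (2 ^+ d)%:E * L2norm f ^+ 2)%E.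
  rewrite sqr_L2norm (@ge0_integral_affine _ _ x _ (fun y => (sqnorm (f y))%:E) t0').
  - by rewrite normrN gtr0_norm ?invr_gt0// invrK.
  - by apply/measurable_EFinP; exact: measurable_sqnorm.
  - by move=> y; rewrite lee_fin sqnorm_ge0.
pose h (y : eucl R d) := 2^-1 * (sqnorm (p y) + sqnorm (q y)).
have mh : measurable_fun setT h.
  apply: measurable_funM; first exact: measurable_cst.
  by apply: measurable_funD; exact: measurable_sqnorm.
have h0 y : 0 <= h y by rewrite mulr_ge0// addr_ge0// sqnorm_ge0.
have Ih : (\int[lebesgue R d]_y (h y)%:E = (2 ^+ d)%:E * L2norm f ^+ 2)%E.
  pose P y := (sqnorm (p y))%:E; pose Q y := (sqnorm (q y))%:E.
  have mP : measurable_fun setT P by apply/measurable_EFinP; exact: measurable_sqnorm.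
  have mQ : measurable_fun setT Q by apply/measurable_EFinP; exact: measurable_sqnorm.
  have P0 y : [set: eucl R d] y -> (0 <= P y)%E by rewrite lee_fin sqnorm_ge0.
  have Q0 y : [set: eucl R d] y -> (0 <= Q y)%E by rewrite lee_fin sqnorm_ge0.
  transitivity (\int[lebesgue R d]_y ((2^-1)%:E * (P \+ Q) y))%E; first by [].
  have PQ0 y : [set: eucl R d] y -> (0 <= (P \+ Q) y)%E.
    by move=> _; apply: adde_ge0; [exact: P0|exact: Q0].
  rewrite (ge0_integralZl_EFin _ measurableT PQ0 (emeasurable_funD mP mQ) (ltW i20)).
  rewrite (ge0_integralD _ measurableT P0 mP Q0 mQ).
  rewrite Ip Iq; set E := (_ * _ ^+ 2)%E.
  have Efin : E \is a fin_num.
    rewrite fin_numM// ge0_fin_numE ?sqr_L2norm_lty//.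
    by rewrite sqr_L2norm integral_ge0// => y _; rewrite lee_fin sqnorm_ge0.
  by rewrite -(fineK Efin) -EFinD -EFinM; congr EFin; lra.
have hfin : ((2 ^+ d)%:E * L2norm f ^+ 2 < +oo)%E.
  by rewrite lte_mul_pinfty// ?lee_fin ?exprn_ge0// sqr_L2norm_lty.
have hint : (lebesgue R d).-integrable setT (EFin \o h).
  apply/integrableP; split; first exact/measurable_EFinP.
  by under eq_integral do rewrite /= ger0_norm//; rewrite Ih.
have -> : ((2 ^+ d)%:E * L2norm f ^+ 2 = (\int[lebesgue R d]_y h y)%:E)%E.
  rewrite /Rintegral -Ih fineK// ge0_fin_numE; first by rewrite Ih.
  by apply: integral_ge0 => y _; rewrite lee_fin.
rewrite lee_fin.
pose g (y : eucl R d) := cexpi (- (2 * pi * dotr xi y)) * p y * conjc (q y).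
have -> : wigner f z = cintegral g.
  congr cintegral; apply/funext => y.
  by rewrite /g /p /q /affine scaleNr.
apply: normc_cintegral_le hint _.
  apply: cmeasurableM; last exact: cmeasurable_conjc.
  apply: cmeasurableM mp; apply: cmeasurable_cexpi.
  apply: measurable_funN; apply: measurable_funM; first exact: measurable_cst.
  exact: measurable_dotr.
move=> y; rewrite /g.
rewrite !ComplexField.Normc.normcM normc_cexpi mul1r normc_conjc /h -!normc_sqnorm.
have := sqr_ge0 (normc (p y) - normc (q y)); rewrite sqrrB; lra.
Qed.

End wigner_bound.

(** * The extremal function: a modulated cube *)

Section extremal_function.
Variables (R : realType) (d : nat).
Local Notation normc := ComplexField.Normc.normc.
Implicit Types (x xi y : 'rV[R]_d).

Lemma cexpi_real_conjM (a b c r s : R) :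
  cexpi a * (cexpi b * Complex r 0) * conjc (cexpi c * Complex s 0) =
  cexpi (a + b - c) * Complex (r * s) 0.
Proof.
rewrite /cexpi cosB sinB cosD sinD; simpc.
by congr Complex; ring.
Qed.

(** A function that is even up to a null set (the boundary of the half-open cube),
    translated by [x] in position and by [xi] in frequency, so that its Wigner
    distribution attains the pointwise bound at [(x, xi)]. *)
Definition modulated_cube x xi : eucl R d -> R[i] :=
  fun y => cexpi (2 * pi * dotr xi y) * Complex (\1_(cube x 1) y) 0.

Lemma sqnorm_modulated_cube x xi y : sqnorm (modulated_cube x xi y) = \1_(cube x 1) y.
Proof.
rewrite /modulated_cube -normc_sqnorm ComplexField.Normc.normcM normc_cexpi mul1r.
rewrite normc_sqnorm /sqnorm/= expr0n/= addr0 indicE.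
by case: (_ \in _); rewrite ?expr1n ?expr0n.
Qed.

Lemma lebesgue_cube1 x : lebesgue R d (cube x 1) = lebesgue R d (cube 0 1).
Proof. by rewrite lebesgue_cube_scale// expr1n mul1e. Qed.

Lemma sqr_L2norm_modulated_cube x xi :
  (L2norm (modulated_cube x xi) ^+ 2 = lebesgue R d (cube 0 1))%E.
Proof.
rewrite sqr_L2norm -(lebesgue_cube1 x).
under eq_integral do rewrite sqnorm_modulated_cube.
by rewrite integral_indic ?setIT//; exact: measurable_cube.
Qed.

Lemma L2_nonzero_modulated_cube x xi :
  (0 < lebesgue R d (cube 0 1))%E -> L2_nonzero (modulated_cube x xi).
Proof.
move=> v0.
have [mr mi] : cmeasurable (modulated_cube x xi).
  apply: cmeasurableM.
    apply: cmeasurable_cexpi; apply: measurable_funM => //; exact: measurable_dotr.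
  by split=> //=; apply: measurable_indic; exact: measurable_cube.
split.
  split=> //; have := sqr_L2norm_modulated_cube x xi; have := lebesgue_cube_lty R d.
  move=> + E; rewrite -E; case: (L2norm _) => [r _| |_]; rewrite ?ltry ?ltNyr//.
move=> [N [mN N0 cN]]; move: v0; rewrite -(lebesgue_cube1 x) ltNge => /negP; apply.
rewrite -N0; apply: le_lebesgue_outer => y xy; apply: cN => /= y0.
have := sqnorm_modulated_cube x xi y; rewrite y0 /sqnorm/= expr0n/= addr0 indicE mem_set//.
by move=> /eqP; rewrite eq_sym oner_eq0.
Qed.

(** The points [y] for which both [x + y / 2] and [x - y / 2] lie in the cube of
    radius 1 around [x0], that is, where the integrand of the Wigner distribution of
    [modulated_cube x0 xi0] at position [x] does not vanish. *)
Definition mid_cube x x0 : set 'rV[R]_d :=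
  affine x 2^-1 @^-1` cube x0 1 `&` affine x (- 2^-1) @^-1` cube x0 1.

Lemma wigner_modulated_cube x0 xi0 (z : eucl R (d + d)) :
  wigner (modulated_cube x0 xi0) z = cintegral (fun y : eucl R d =>
    cexpi (2 * pi * dotr (xi0 - rsubmx (z : 'rV[R]_(d + d))) y) *
    Complex (\1_(mid_cube (lsubmx (z : 'rV[R]_(d + d))) x0) y) 0).
Proof.
rewrite /wigner; congr cintegral; apply/funext => y.
set x := lsubmx _; set xi := rsubmx _.
have dotD (a b c : 'rV[R]_d) : dotr a (b + c) = dotr a b + dotr a c.
  by rewrite /dotr -big_split/=; apply: eq_bigr => i _; rewrite mxE mulrDr.
have dotZ (a b : 'rV[R]_d) (s : R) : dotr a (s *: b) = s * dotr a b.
  by rewrite /dotr mulr_sumr; apply: eq_bigr => i _; rewrite mxE mulrCA.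
have dotB (a b c : 'rV[R]_d) : dotr (a - b) c = dotr a c - dotr b c.
  by rewrite /dotr -sumrB; apply: eq_bigr => i _; rewrite !mxE mulrBl.
rewrite /modulated_cube cexpi_real_conjM; congr (cexpi _ * Complex _ 0).
  by rewrite -[- (2^-1 *: y)]scaleNr !dotD !dotZ dotB; field.
rewrite /indic -natrM mulnb; congr (_%:R); congr nat_of_bool.
have -> : x - 2^-1 *: y = affine x (- 2^-1) y by rewrite /affine scaleNr.
by rewrite in_setI.
Qed.

End extremal_function.

Section wigner_lower_bound.
Variables (R : realType) (d : nat).
Local Notation normc := ComplexField.Normc.normc.

Lemma measurable_mid_cube (x x0 : 'rV[R]_d) :
  measurable (mid_cube x x0 : set (eucl R d)).
Proof.
have i20 : 2^-1 != 0 :> R by rewrite invr_eq0.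
apply: (@measurableI _ (eucl R d)); rewrite -[X in measurable X]setTI.
  exact: (measurable_affine x i20 measurableT (measurable_cube x0 1)).
have i20' : - 2^-1 != 0 :> R by rewrite oppr_eq0.
exact: (measurable_affine x i20' measurableT (measurable_cube x0 1)).
Qed.

Lemma mid_cube_bound (x x0 y : 'rV[R]_d) i : mid_cube x x0 y -> `|y ord0 i| <= 2.
Proof.
move=> [/(_ i) + /(_ i)]; rewrite !mxE ler_norml => /andP[h1 h2] /andP[h3 h4].
by apply/andP; split; lra.
Qed.

Lemma sub_cube_mid_cube (x x0 : 'rV[R]_d) e : cube x0 e x ->
  cube 0 (2 * (1 - e)) `<=` mid_cube x x0.
Proof.
move=> xe y ye; split=> i; rewrite !mxE; have := xe i; have := ye i; rewrite !mxE;
  move=> /andP[h1 h2] /andP[h3 h4]; apply/andP; split; lra.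
Qed.

Lemma mid_cube_lty (x x0 : 'rV[R]_d) : (lebesgue R d (mid_cube x x0) < +oo)%E.
Proof.
have S3 : mid_cube x x0 `<=` cube 0 3.
  move=> y /mid_cube_bound yb i; have := yb i; rewrite mxE ler_norml => /andP[h1 h2].
  by apply/andP; split; lra.
apply: le_lt_trans (le_lebesgue_outer S3) _.
rewrite -[lebesgue_outer _]/(lebesgue R d (cube 0 3)) lebesgue_cube_scale ?ltr0n//.
by rewrite lte_mul_pinfty ?lee_fin ?exprn_ge0// lebesgue_cube_lty.
Qed.

Lemma normr_dotr_le (a b : 'rV[R]_d) (A B : R) :
  (forall i, `|a ord0 i| <= A) -> (forall i, `|b ord0 i| <= B) ->
  `|dotr a b| <= d%:R * (A * B).
Proof.
move=> aA bB; apply: le_trans (ler_norm_sum _ _ _) _.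
apply: le_trans (ler_sum _ (_ : forall i, true -> _ <= A * B)) _.
  by move=> i _; rewrite normrM ler_pM.
by rewrite sumr_const card_ord mulr_natl.
Qed.

(** A lower bound for the Wigner distribution of the modulated cube at distance at
    most [e] from its centre, relative to the squared norm: the phase is at most
    [2 pi d (2 e)] on [mid_cube], which contains a cube of radius [2 (1 - e)]. *)
Definition lower_factor (e : R) : R :=
  cos (2 * pi * (d%:R * (e * 2))) * (2 * (1 - e)) ^+ d.

(** The condition [8 d e <= 1] keeps the phase within [pi / 2], where the cosine is
    nonnegative and decreases with the modulus. *)
Lemma wigner_modulated_cube_ge (z0 z : 'rV[R]_(d + d)) (e v : R) :
  0 < e -> e < 1 -> 8 * d%:R * e <= 1 ->
  lebesgue R d (cube 0 1) = v%:E -> cube z0 e z ->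
  lower_factor e * v <= normc (wigner (modulated_cube (lsubmx z0) (rsubmx z0)) z).
Proof.
move=> e0 e1 de vE ze.
set x := lsubmx z; set xi := rsubmx z; set x0 := lsubmx z0; set xi0 := rsubmx z0.
have v0 : 0 <= v by rewrite -lee_fin -vE measure_ge0.
have xe : cube x0 e x by move=> i; have := ze (lshift d i); rewrite !mxE.
have xie i : `|(xi0 - xi) ord0 i| <= e.
  have := ze (rshift d i); rewrite !mxE ler_norml => /andP[h1 h2].
  by apply/andP; split; lra.
pose S : set (eucl R d) := mid_cube x x0.
pose th (y : eucl R d) := 2 * pi * dotr (xi0 - xi) y.
pose t := 2 * pi * (d%:R * (e * 2)).
have pi0 := pi_gt0 R.
have tpi : 0 <= t <= pi / 2.
  rewrite /t; apply/andP; split.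
    by rewrite !mulr_ge0// ltW.
  have : pi * (8 * d%:R * e) <= pi * 1 by rewrite ler_pM2l.
  lra.
have thS y : S y -> cos t <= cos (th y).
  move=> Sy; have ty : `|th y| <= t.
    rewrite /th normrM (gtr0_norm (_ : 0 < 2 * pi)) ?mulr_gt0//.
    rewrite ler_pM2l ?mulr_gt0//; apply: normr_dotr_le => // i.
    exact: mid_cube_bound Sy.
  rewrite -(cos_norm (th y)) leNgt; apply/negP.
  have /andP[t0 t2] := tpi.
  rewrite ltr_cos ?in_itv/= ?normr_ge0/=; [|lra|lra].
  by rewrite ltNge ty.
have cost0 : 0 <= cos t by apply: cos_ge0_pihalf; have /andP[? ?] := tpi; lra.
have mS : measurable S by exact: measurable_mid_cube.
have i1S : (lebesgue R d).-integrable setT (fun y : eucl R d => (\1_S y)%:E).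
  apply/integrableP; split; first by apply/measurable_EFinP; exact: measurable_indic.
  under eq_integral do rewrite abse_EFin ger0_norm//.
  by rewrite integral_indic// setIT; exact: mid_cube_lty.
have mth : measurable_fun setT th.
  apply: measurable_funM; first exact: measurable_cst.
  exact: measurable_dotr.
have iRe : (lebesgue R d).-integrable setT (EFin \o (fun y : eucl R d => cos (th y) * \1_S y)).
  apply: le_integrable i1S => //.
    apply/measurable_EFinP; apply: measurable_funM.
      exact: (measurableT_comp (continuous_measurable_fun (@continuous_cos R)) mth).
    exact: measurable_indic.
  move=> y _ /=; rewrite lee_fin normrM ler_piMl//; exact: cos_max.
have ReW : complex.Re (wigner (modulated_cube x0 xi0) z) = \int[lebesgue R d]_y (cos (th y) * \1_S y).
  rewrite wigner_modulated_cube /cintegral/=; apply: eq_Rintegral => y _.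
  by rewrite mulr0 subr0.
apply: le_trans (le_trans (ler_norm _) (normr_Re_le _)); rewrite ReW.
have -> : lower_factor e * v = cos t * fine (lebesgue R d (cube 0 (2 * (1 - e)))).
  rewrite lebesgue_cube_scale; last by rewrite mulr_gt0// subr_gt0.
  by rewrite vE -EFinM /= /lower_factor -/t -[LHS]mulrA.
apply: (@le_trans _ _ (cos t * \int[lebesgue R d]_y \1_S y)).
  apply: ler_wpM2l => //.
  rewrite /Rintegral integral_indic// setIT.
  apply: fine_le.
  - rewrite lebesgue_cube_scale; last by rewrite mulr_gt0// subr_gt0.
    by rewrite vE.
  - rewrite ge0_fin_numE ?measure_ge0//; exact: mid_cube_lty.
  - exact: le_lebesgue_outer (sub_cube_mid_cube xe).
rewrite -RintegralZl//; apply: le_Rintegral => //.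
- exact: (@integrableZl _ _ _ (lebesgue R d) setT measurableT (cos t) _ i1S).
- move=> y _; rewrite indicE; case: (boolP (y \in S)) => [|_]; last by rewrite !mulr0.
  by rewrite inE !mulr1; exact: thS.
Qed.

End wigner_lower_bound.

(** * Essential suprema over the set *)

Section conclusion.
Variables (R : realType) (d : nat).
Local Notation normc := ComplexField.Normc.normc.

Lemma lower_factor_limit (v b : R) :
  (forall e, 0 < e -> e < 1 -> 8 * d%:R * e <= 1 -> lower_factor d e * v <= b) ->
  2 ^+ d * v <= b.
Proof.
move=> H.
have cv : (fun e : R => lower_factor d e * v) @ (0:R)^'+ --> lower_factor d 0 * v.
  apply: cvgM; last exact: cvg_cst.
  apply: cvg_at_right_filter; rewrite /lower_factor; apply: cvgM.
    apply: (@continuous_comp _ _ _ (fun e : R => 2 * pi * (d%:R * (e * 2))) cos);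
      last exact: continuous_cos.
    apply: cvgM; first exact: cvg_cst.
    apply: cvgM; first exact: cvg_cst.
    by apply: cvgM; [exact: cvg_id|exact: cvg_cst].
  apply: (@continuous_comp _ _ _ (fun e : R => 2 * (1 - e)) (fun x => x ^+ d));
    last exact: exprn_continuous.
  apply: cvgM; first exact: cvg_cst.
  by apply: cvgB; [exact: cvg_cst|exact: cvg_id].
have <- : lower_factor d 0 = 2 ^+ d :> R.
  by rewrite /lower_factor mul0r !mulr0 cos0 subr0 mulr1 mul1r.
apply: (cvgr_to_le cv).
have d8 : 0 < (8 * d%:R + 1)^-1 :> R by rewrite invr_gt0 ltr_wpDl// mulr_ge0.
near=> e; have e0 : 0 < e by near: e; exact: nbhs_right_gt.
have e1 : e < 1 by near: e; apply: nbhs_right_lt; exact: ltr01.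
have : e <= (8 * d%:R + 1)^-1 by near: e; exact: nbhs_right_le.
move=> ed; apply: H => //; move: ed.
rewrite -[_^-1]mul1r ler_pdivlMr; first by lra.
by rewrite ltr_wpDl// mulr_ge0.
Unshelve. all: by end_near. Qed.

Variables (Omega : set (eucl R (d + d))) (mOmega : measurable Omega).
Variable Omega_gt0 : (0 < lebesgue R (d + d) Omega)%E.

Let mrestr_gt0 : (0 < mrestr (lebesgue R (d + d)) mOmega setT)%E.
Proof. by rewrite /mrestr setTI. Qed.

Lemma Linfnorm_wigner_le (f : eucl R d -> R[i]) : L2 f ->
  (Linfnorm mOmega (wigner f) <= (2 ^+ d)%:E * L2norm f ^+ 2)%E.
Proof.
move=> Lf; rewrite /Linfnorm unlock mrestr_gt0.
apply/ess_sup_inf.ess_supP; apply: nearW => z /=.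
by rewrite ger0_norm ?normc_ge0//; exact: wigner_le.
Qed.

(** An essential bound on [Omega] fails only on a null set, which cannot contain
    the part of [Omega] close to [z0]; so it is at least each value
    [lower_factor d e * v], and these tend to [2 ^+ d * v]. *)
Lemma Linfnorm_wigner_modulated_cube_ge (z0 : 'rV[R]_(d + d)) :
  (forall r, 0 < r -> (0 < lebesgue R (d + d) (Omega `&` cube z0 r))%E) ->
  ((2 ^+ d)%:E * lebesgue R d (cube 0 1) <=
   Linfnorm mOmega (wigner (modulated_cube (lsubmx z0) (rsubmx z0))))%E.
Proof.
move=> z0P; set f := modulated_cube _ _.
have [v vE] : exists v : R, lebesgue R d (cube 0 1) = v%:E.
  exists (fine (lebesgue R d (cube 0 1))).
  by rewrite fineK// ge0_fin_numE ?measure_ge0// lebesgue_cube_lty.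
rewrite vE /Linfnorm unlock mrestr_gt0.
apply/ereal_infP => b /= [N [mN N0 aeN]].
have ptw e : 0 < e -> e < 1 -> 8 * d%:R * e <= 1 -> ((lower_factor d e * v)%:E <= b)%E.
  move=> e0 e1 de; rewrite leNgt; apply/negP => be.
  have := z0P _ e0; rewrite ltNge => /negP; apply.
  rewrite -N0 /mrestr; apply: le_lebesgue_outer => z [Oz ze]; split=> //.
  apply: aeN => /=; apply/negP; rewrite -ltNge; apply: (lt_le_trans be).
  rewrite lee_fin ger0_norm ?normc_ge0//.
  exact: wigner_modulated_cube_ge.
case: b ptw {aeN} => [b| |] ptw; last 2 first.
- by rewrite leey.
- (* Any admissible radius excludes the bound -oo. *)
  have := ptw ((8 * d%:R + 2)^-1).
  have d8 : 0 < 8 * d%:R + 2 :> R by rewrite ltr_wpDl// mulr_ge0.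
  rewrite invr_gt0 d8 invf_lt1// => /(_ isT); rewrite ltr_wpDl ?mulr_ge0// ?ltr1n// => /(_ isT).
  by rewrite ler_pdivrMr// mul1r lerDl ler0n => /(_ isT); rewrite leeNy_eq.
rewrite -EFinM lee_fin; apply: lower_factor_limit => e e0 e1 de.
by rewrite -lee_fin ptw.
Qed.

End conclusion.

Unset Implicit Arguments.

Theorem proposition5p1 (R : realType) (d : nat) (d_gt0 : (0 < d)%N)
    (Omega : set (eucl R (d + d))) (mOmega : measurable Omega)
    (Omega_gt0 : (0 < lebesgue R (d + d) Omega)%E)
    (Omega_fin : (lebesgue R (d + d) Omega < +oo)%E) :
  ereal_sup [set (Linfnorm mOmega (wigner f) / L2norm f ^+ 2)%E
            | f in @L2_nonzero R d] = (2 ^+ d)%:E /\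
  exists2 f, @L2_nonzero R d f &
    (Linfnorm mOmega (wigner f) / L2norm f ^+ 2)%E = (2 ^+ d)%:E.
Proof.
have ub f : @L2_nonzero R d f ->
    (Linfnorm mOmega (wigner f) / L2norm f ^+ 2 <= (2 ^+ d)%:E)%E.
  move=> f0; have := Linfnorm_wigner_le mOmega Omega_gt0 f0.1.
  have := sqr_L2norm_gt0 f0; have := sqr_L2norm_lty f0.1.
  case: (L2norm f ^+ 2)%E => [r| |]// _; rewrite lte_fin => r0.
  have -> : (r%:E^-1 = r^-1%:E)%E by rewrite /inve gt_eqF.
  by rewrite lee_pdivrMr.
have v0 := lebesgue_cube_gt0 Omega_gt0.
have [z0 z0P] := exists_support_point Omega_gt0.
pose f := modulated_cube (lsubmx z0) (rsubmx z0).
have f0 : L2_nonzero f by exact: L2_nonzero_modulated_cube.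
have fE : (Linfnorm mOmega (wigner f) / L2norm f ^+ 2)%E = (2 ^+ d)%:E.
  apply/eqP; rewrite eq_le ub// andTb.
  have := Linfnorm_wigner_modulated_cube_ge mOmega Omega_gt0 z0P.
  rewrite -(sqr_L2norm_modulated_cube (lsubmx z0) (rsubmx z0)) -/f.
  have := sqr_L2norm_gt0 f0; have := sqr_L2norm_lty f0.1.
  case: (L2norm f ^+ 2)%E => [r| |]// _; rewrite lte_fin => r0.
  have -> : (r%:E^-1 = r^-1%:E)%E by rewrite /inve gt_eqF.
  by rewrite lee_pdivlMr.
split; last by exists f.
apply/eqP; rewrite eq_le; apply/andP; split.
  by apply: ge_ereal_sup => _ [g g0 <-]; exact: ub.
by rewrite -fE; apply: ereal_sup_ubound; exists f.
Qed.
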